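(* Let $d\ge 1$ be an integer and let $\gamma$ be a rational curve on $\operatorname{SO}_4(\mathbb{R})$ of degree $2d$. Then $\gamma$ is a product of $d$ quadratic rational curves on $\operatorname{SO}_4(\mathbb{R})$, i.e. there are rational curves $\gamma_1,\dots,\gamma_d$ on $\operatorname{SO}_4(\mathbb{R})$, each of degree $2$, such that $\gamma(t)=\gamma_1(t)\cdots\gamma_d(t)$ for all $t\in\mathbb{R}$.
   Context: $\operatorname{SO}_4(\mathbb{R})$ is the group of $X\in\mathbb{R}^{4\times 4}$ with $XX^\top=I_4$ and $\det X=1$. A rational curve on $\operatorname{SO}_4(\mathbb{R})$ is a map $\gamma:\mathbb{R}\to\operatorname{SO}_4(\mathbb{R})$ of the form $\gamma(t)=(p_{ij}(t)/q(t))_{1\le i,j\le 4}$ with $q,p_{ij}\in\mathbb{R}[t]$, where $q$ has no real root, $\gcd(p_{11},p_{12},\dots,p_{44},q)=1$ and $\deg q\ge\deg p_{ij}$ for all $i,j$. Its degree is $\deg(\gamma):=\deg(q)$, which is always an even non-negative integer. A quadratic rational curve is a rational curve on $\operatorname{SO}_4(\mathbb{R})$ of degree $2$. *)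

(* Defs.v *)
From HB Require Import structures.
From mathcomp Require Import all_boot all_order all_algebra.
From mathcomp Require Import reals.
Set Implicit Arguments.
Unset Strict Implicit.
Unset Printing Implicit Defensive.
Import Order.TTheory GRing.Theory Num.Theory.
Local Open Scope ring_scope.

Definition SO4 (R : realType) : {pred 'M[R]_4} :=
  [pred X : 'M[R]_4 | (X *m X^T == 1%:M) && (\det X == 1)].
Arguments SO4 {R}.

(* [gcdp] is defined only up to a nonzero constant, so that "the gcd is 1" is
   expressed with [%=].  As [size p] is the degree of [p] plus one (and
   [size 0 = 0]), the comparison of sizes is the comparison of degrees. *)
Record curve_presentation (R : realType) (gamma : R -> 'M[R]_4)
    (P : 'M[{poly R}]_4) (q : {poly R}) : Prop := CurvePresentation {
  presentation_noroot : forall t, ~~ root q t;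
  presentation_gcd :
    \big[@gcdp R/q]_(ij : 'I_4 * 'I_4) P ij.1 ij.2 %= 1;
  presentation_size : forall i j, (size (P i j) <= size q)%N;
  presentation_eval : forall t,
    gamma t = \matrix_(i < 4, j < 4) ((P i j).[t] / q.[t]) }.

(* [gamma] is a rational curve on SO_4(R) and its degree is [n]; the degree
   depends only on [gamma], see [rational_curve_degree_unique]. *)
Definition rational_curve_of_degree (R : realType) (gamma : R -> 'M[R]_4)
    (n : nat) : Prop :=
  (forall t, gamma t \in SO4) /\
  exists (P : 'M[{poly R}]_4) (q : {poly R}),
    curve_presentation gamma P q /\ size q = n.+1.

Lemma presentation_dvd (R : realType) (gamma : R -> 'M[R]_4)
    (P P' : 'M[{poly R}]_4) (q q' : {poly R}) :
  curve_presentation gamma P q -> curve_presentation gamma P' q' -> q %| q'.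
Proof.
move=> [nr cop _ ev] [nr' _ _ ev'].
have cross i j : q' * P i j = q * P' i j.
  apply/eqP; rewrite -subr_eq0; apply/eqP.
  apply: (@roots_geq_poly_eq0 _ _ [seq n%:R | n <- iota 0 (size (q' * P i j - q * P' i j))]).
  - apply/allP => t _; rewrite /root !hornerE subr_eq0.
    have := congr1 (fun M : 'M[R]_4 => M i j) (etrans (esym (ev t)) (ev' t)).
    rewrite !mxE => /eqP; rewrite eqr_div; last 2 first.
    + exact: nr.
    + exact: nr'.
    by rewrite mulrC [X in _ == X]mulrC.
  - by rewrite map_inj_uniq ?iota_uniq//; exact: mulrIn (oner_neq0 _).
  - by rewrite size_map size_iota.
suff : q %| q' * \big[@gcdp R/q]_(ij : 'I_4 * 'I_4) P ij.1 ij.2.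
  by rewrite (eqp_dvdr _ (eqp_mull q' cop)) mulr1.
elim/big_rec : _ => [|ij g _ dg]; first exact: dvdp_mulIr.
rewrite (eqp_dvdr _ (mulp_gcdr _ _ _)) dvdp_gcd dg andbT cross.
exact: dvdp_mulIl.
Qed.

Lemma rational_curve_degree_unique (R : realType) (gamma : R -> 'M[R]_4)
    (m n : nat) :
  rational_curve_of_degree gamma m -> rational_curve_of_degree gamma n -> m = n.
Proof.
move=> [_ [P [q [pq sq]]]] [_ [P' [q' [pq' sq']]]].
have /eqp_size : q %= q'.
  by rewrite /eqp (presentation_dvd pq pq') (presentation_dvd pq' pq).
by rewrite sq sq' => -[].
Qed.

(* Main.v *)
Require Import Defs.
From HB Require Import structures.
From mathcomp Require Import all_boot all_order all_algebra.
From mathcomp Require Import reals.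
From mathcomp Require Import complex.
From mathcomp Require Import ring lra.
Set Implicit Arguments.
Unset Strict Implicit.
Unset Printing Implicit Defensive.
Import Order.TTheory GRing.Theory Num.Theory.
Local Open Scope ring_scope.

(* With R^4 the quaternions, every curve on SO_4 has the form x |-> a x b / q for
   quaternion polynomials a, b without a common real factor: the coefficients of
   the matrix on the basis of the maps x |-> e_i x e_j form a rank one matrix.
   Then N(a) N(b) = q^2 and deg q is the degree of the curve.  Let M be a
   quadratic factor of q.  Since M^2 divides N(a) N(b), one splits off linear
   quaternion factors of norm M: one from the left of a and one from the right of
   b, or two from a, or two from b.  In each case they form a quadratic curve
   with denominator M, and q / M is left. *)

Local Notation o0 := (@Ordinal 4 0 isT).
Local Notation o1 := (@Ordinal 4 1 isT).
Local Notation o2 := (@Ordinal 4 2 isT).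
Local Notation o3 := (@Ordinal 4 3 isT).

Lemma ord4P (P : 'I_4 -> Prop) : P o0 -> P o1 -> P o2 -> P o3 -> forall i, P i.
Proof.
by move=> p0 p1 p2 p3 [[|[|[|[|//]]]] ltk]; rewrite (bool_irrelevance ltk isT).
Qed.

Lemma sum4 (V : nmodType) (F : 'I_4 -> V) :
  \sum_i F i = F o0 + F o1 + F o2 + F o3.
Proof.
by rewrite !big_ord_recl big_ord0 addr0 !addrA; do !congr (_ + _); congr F; apply/val_inj.
Qed.

(** * Quaternions and 4 x 4 matrices over a commutative ring *)

Section Quaternions.
Variable K : comNzRingType.
Implicit Types (a b : 'cV[K]_4) (X : 'M[K]_4).

Definition tab4 (s : seq (seq K)) (i j : 'I_4) : K := nth 0 (nth [::] s i) j.

(* The column [a] stands for a0 + a1 i + a2 j + a3 k, and [lmx a], [rmx b] for the maps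
   x |-> a x and x |-> x b; thus [lmx a *m b] is the product of quaternions. *)
Definition lmx a : 'M[K]_4 :=
  let x i := a i 0 in
  \matrix_(i, j) tab4
    [:: [:: x o0; - x o1; - x o2; - x o3];
        [:: x o1;   x o0; - x o3;   x o2];
        [:: x o2;   x o3;   x o0; - x o1];
        [:: x o3; - x o2;   x o1;   x o0]] i j.

Definition rmx b : 'M[K]_4 :=
  let x i := b i 0 in
  \matrix_(i, j) tab4
    [:: [:: x o0; - x o1; - x o2; - x o3];
        [:: x o1;   x o0;   x o3; - x o2];
        [:: x o2; - x o3;   x o0;   x o1];
        [:: x o3;   x o2; - x o1;   x o0]] i j.

Definition qconj a : 'cV[K]_4 := \col_i (if i == 0 then a i 0 else - a i 0).
Definition qnorm a : K := \sum_i a i 0 ^+ 2.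

Ltac entrywise :=
  let i := fresh in let j := fresh in
  apply/matrixP => i j; rewrite !mxE ?sum4 ?mxE /= ?sum4 ?mxE ?big_ord1 ?mxE;
  move: i j; do 2!elim/ord4P; rewrite /tab4 /=; try ring.

Lemma lmxM a b : lmx (lmx a *m b) = lmx a *m lmx b.
Proof. entrywise. Qed.

Lemma rmxM a b : rmx (lmx a *m b) = rmx b *m rmx a.
Proof. entrywise. Qed.

Lemma lrmxC a b : lmx a *m rmx b = rmx b *m lmx a.
Proof. entrywise. Qed.

Lemma lmxV a : lmx a *m (lmx a)^T = (qnorm a)%:M.
Proof. rewrite /qnorm; entrywise. Qed.

Lemma rmxV a : rmx a *m (rmx a)^T = (qnorm a)%:M.
Proof. rewrite /qnorm; entrywise. Qed.

(* Van Elfrinkhof's associate matrix: four times the coefficients of [X] on the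
   basis [lmx e_i *m rmx e_j]. *)
Definition assoc X (i j : 'I_4) : K := tab4
  [:: [:: X o0 o0 + X o1 o1 + X o2 o2 + X o3 o3;
        - X o0 o1 + X o1 o0 + X o2 o3 - X o3 o2;
        - X o0 o2 - X o1 o3 + X o2 o0 + X o3 o1;
        - X o0 o3 + X o1 o2 - X o2 o1 + X o3 o0];
      [:: - X o0 o1 + X o1 o0 - X o2 o3 + X o3 o2;
        - X o0 o0 - X o1 o1 + X o2 o2 + X o3 o3;
          X o0 o3 - X o1 o2 - X o2 o1 + X o3 o0;
        - X o0 o2 - X o1 o3 - X o2 o0 - X o3 o1];
      [:: - X o0 o2 + X o1 o3 + X o2 o0 - X o3 o1;
        - X o0 o3 - X o1 o2 - X o2 o1 - X o3 o0;
        - X o0 o0 + X o1 o1 - X o2 o2 + X o3 o3;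
          X o0 o1 + X o1 o0 - X o2 o3 - X o3 o2];
      [:: - X o0 o3 - X o1 o2 + X o2 o1 + X o3 o0;
          X o0 o2 - X o1 o3 + X o2 o0 - X o3 o1;
        - X o0 o1 - X o1 o0 - X o2 o3 - X o3 o2;
        - X o0 o0 + X o1 o1 + X o2 o2 - X o3 o3]] i j.

(** The matrix of x |-> sum of C i j e_i x e_j, which inverts [assoc] up to the factor 4. *)
Definition unassoc (C : 'I_4 -> 'I_4 -> K) : 'M[K]_4 := \matrix_(i, j) tab4
  [:: [:: C o0 o0 - C o1 o1 - C o2 o2 - C o3 o3;
        - C o0 o1 - C o1 o0 + C o2 o3 - C o3 o2;
        - C o0 o2 - C o1 o3 - C o2 o0 + C o3 o1;
        - C o0 o3 + C o1 o2 - C o2 o1 - C o3 o0];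
      [:: C o0 o1 + C o1 o0 + C o2 o3 - C o3 o2;
          C o0 o0 - C o1 o1 + C o2 o2 + C o3 o3;
          C o0 o3 - C o1 o2 - C o2 o1 - C o3 o0;
        - C o0 o2 - C o1 o3 + C o2 o0 - C o3 o1];
      [:: C o0 o2 - C o1 o3 + C o2 o0 + C o3 o1;
        - C o0 o3 - C o1 o2 - C o2 o1 + C o3 o0;
          C o0 o0 + C o1 o1 - C o2 o2 + C o3 o3;
          C o0 o1 - C o1 o0 - C o2 o3 - C o3 o2];
      [:: C o0 o3 + C o1 o2 - C o2 o1 + C o3 o0;
          C o0 o2 - C o1 o3 - C o2 o0 - C o3 o1;
        - C o0 o1 + C o1 o0 - C o2 o3 - C o3 o2;
          C o0 o0 + C o1 o1 + C o2 o2 - C o3 o3]] i j.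

(** Laplace expansion along the first row, written out so that [ring] can treat the determinant as a
    polynomial in the entries. *)
Definition det4 (f : 'I_4 -> 'I_4 -> K) :=
  let m i j := f o2 i * f o3 j - f o2 j * f o3 i in
  f o0 o0 * (f o1 o1 * m o2 o3 - f o1 o2 * m o1 o3 + f o1 o3 * m o1 o2)
  - f o0 o1 * (f o1 o0 * m o2 o3 - f o1 o2 * m o0 o3 + f o1 o3 * m o0 o2)
  + f o0 o2 * (f o1 o0 * m o1 o3 - f o1 o1 * m o0 o3 + f o1 o3 * m o0 o1)
  - f o0 o3 * (f o1 o0 * m o1 o2 - f o1 o1 * m o0 o2 + f o1 o2 * m o0 o1).

Lemma eq_unassoc C D : (forall i j, C i j = D i j) -> unassoc C = unassoc D.
Proof. by move=> e; apply/matrixP => i j; rewrite !mxE !e. Qed.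

Lemma lrmx_unassoc a b : lmx a *m rmx b = unassoc (fun i j => a i 0 * b j 0).
Proof. entrywise. Qed.

Lemma assocK X : unassoc (assoc X) = 4%:R *: X.
Proof.
apply/matrixP => i j; rewrite !mxE.
elim/ord4P: i; elim/ord4P: j; rewrite /assoc /tab4 /=; ring.
Qed.

Lemma assoc_lrmx a b i j : assoc (lmx a *m rmx b) i j = 4%:R * (a i 0 * b j 0).
Proof.
elim/ord4P: i; elim/ord4P: j; rewrite /assoc /tab4 /= !mxE !sum4 !mxE /tab4 /=; ring.
Qed.

Lemma assocZ c X i j : assoc (c *: X) i j = c * assoc X i j.
Proof. elim/ord4P: i; elim/ord4P: j; rewrite /assoc /tab4 /= !mxE; ring. Qed.

Lemma lmxZ c a : lmx (c *: a) = c *: lmx a.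
Proof. entrywise. Qed.

Lemma lmx_conj_mul a b : lmx (lmx a *m qconj b) *m b = qnorm b *: a.
Proof.
apply/matrixP => i j; rewrite {j}(ord1 j) /qnorm !mxE !sum4 !mxE !sum4 !mxE.
by elim/ord4P: i; rewrite /tab4 /=; ring.
Qed.

Lemma qconjM a b : qconj (lmx a *m b) = lmx (qconj b) *m qconj a.
Proof.
apply/matrixP => i j; rewrite {j}(ord1 j) !mxE !sum4 !mxE.
by elim/ord4P: i; rewrite /tab4 /=; ring.
Qed.

Lemma qconjK : involutive qconj.
Proof.
move=> a; apply/matrixP => i j; rewrite {j}(ord1 j) !mxE.
by elim/ord4P: i => /=; rewrite ?opprK.
Qed.

Lemma qnorm_conj a : qnorm (qconj a) = qnorm a.
Proof. by rewrite /qnorm !sum4 !mxE /= !sqrrN. Qed.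

Lemma qnormM a b : qnorm (lmx a *m b) = qnorm a * qnorm b.
Proof. rewrite /qnorm !sum4 !mxE !sum4 !mxE /tab4 /=; ring. Qed.

Lemma qnormZ c a : qnorm (c *: a) = c ^+ 2 * qnorm a.
Proof. rewrite /qnorm !sum4 !mxE; ring. Qed.

Lemma lrmxV a b : (lmx a *m rmx b) *m (lmx a *m rmx b)^T = (qnorm a * qnorm b)%:M.
Proof.
rewrite trmx_mul mulmxA -(mulmxA (lmx a)) rmxV mul_mx_scalar -scalemxAl lmxV.
by rewrite scale_scalar_mx mulrC.
Qed.

(** Lagrange's identity, where each minor occurs for (j, l) and for (l, j), whence the factor 2. It
    links the 2 x 2 minors of a matrix to the Gram matrix of its rows. *)
Lemma lagrange4 (u v : 'I_4 -> K) :
  \sum_j \sum_l (u j * v l - u l * v j) ^+ 2 =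
  2%:R * ((\sum_j u j ^+ 2) * (\sum_j v j ^+ 2) - (\sum_j u j * v j) ^+ 2).
Proof. rewrite !sum4; ring. Qed.

(* The left side is twice the sum of the squares of the 2 x 2 minors of [assoc X], a
   quartic form of [X] invariant under SO_4 x SO_4; hence it is determined by its values
   on diagonal matrices. *)
Lemma assoc_gram X :
  let G i k := \sum_j assoc X i j * assoc X k j in
  let H i k := \sum_j X i j * X k j in
  \sum_i \sum_k (G i i * G k k - G i k ^+ 2) =
  4%:R * (\sum_i H i i) ^+ 2 + 8%:R * (\sum_i \sum_k H i k ^+ 2)
  - 96%:R * det4 X.
Proof.
move=> G H; rewrite /G /H !sum4 /assoc /tab4 /= /det4; ring.
Qed.

Lemma det_mx22 (A : 'M[K]_2) :
  \det A = A 0 0 * A ord_max ord_max - A 0 ord_max * A ord_max 0.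
Proof.
rewrite (expand_det_row _ ord0) !(big_ord_recl, big_ord0) /cofactor !det_mx11 !mxE.
have -> : lift ord0 ord0 = ord_max :> 'I_2 by apply/val_inj.
have -> : lift ord_max ord0 = ord0 :> 'I_2 by apply/val_inj.
rewrite /=; ring.
Qed.

Lemma det4E X : \det X = det4 X.
Proof.
(* Indexing by natural numbers lets the ordinals that [lift] produces in the expansions reduce to
   numerals. *)
pose f i j := X (inord i) (inord j).
have fE i j : X i j = f i j by rewrite /f !inord_val.
rewrite /det4 !fE /=.
rewrite (expand_det_row _ ord0) !(big_ord_recl, big_ord0) /cofactor.
rewrite !(expand_det_row _ ord0) !(big_ord_recl, big_ord0) /cofactor.
rewrite !det_mx22 !mxE !fE /=; ring.
Qed.

Lemma det_lmx a : \det (lmx a) = qnorm a ^+ 2.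
Proof. rewrite det4E /det4 /qnorm sum4 !mxE /tab4 /=; ring. Qed.

Lemma det_rmx a : \det (rmx a) = qnorm a ^+ 2.
Proof. rewrite det4E /det4 /qnorm sum4 !mxE /tab4 /=; ring. Qed.

End Quaternions.

(** * Real polynomials: sums of squares and quadratic factors *)

Section Polynomials.
Variable R : realType.
Implicit Types (p q f M : {poly R}).

Lemma poly_fun_ext p q : (forall t, p.[t] = q.[t]) -> p = q.
Proof.
move=> e; apply/eqP; rewrite -subr_eq0; apply/eqP.
apply: (@roots_geq_poly_eq0 _ _ [seq n%:R | n <- iota 0 (size (p - q))]).
- by apply/allP => t _; rewrite /root !hornerE e subrr.
- by rewrite map_inj_uniq ?iota_uniq//; exact: mulrIn (oner_neq0 _).
- by rewrite size_map size_iota.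
Qed.

Lemma sum_sqr_eq0 (f : 'I_4 -> R) : \sum_i f i ^+ 2 = 0 -> forall i, f i = 0.
Proof.
move=> e i; apply/eqP; rewrite -sqrf_eq0; apply/eqP.
by apply: (psumr_eq0P _ e) => // k _; exact: sqr_ge0.
Qed.

Lemma coef_sqr_top p k : (size p <= k.+1)%N -> (p ^+ 2)`_(k + k) = p`_k ^+ 2.
Proof.
move=> sp; have kk : (k < (k + k).+1)%N by rewrite ltnS leq_addr.
rewrite expr2 coefM (bigD1 (Ordinal kk)) //= addnK big1 ?addr0 // => j jk.
case: (ltngtP j k) => [ltjk|ltkj|ejk].
- by rewrite [q in _ * q]nth_default ?mulr0 // (leq_trans sp) // ltn_subRL ltn_add2r.
- by rewrite [q in q * _]nth_default ?mul0r // (leq_trans sp).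
- by case/eqP: jk; apply/val_inj.
Qed.

(** Leading terms of real squares cannot cancel: if the largest size among the [f i] exceeded that
    of [p], the squares of the coefficients in that top degree would sum to 0. *)
Lemma size_sum_sqr (f : 'I_4 -> {poly R}) p :
  \sum_i f i ^+ 2 = p ^+ 2 -> forall i, (size (f i) <= size p)%N.
Proof.
move=> e; pose m := \max_i size (f i).
have fm i : (size (f i) <= m)%N by exact: leq_bigmax.
case: (leqP m (size p)) => [mp i|]; first exact: leq_trans (fm i) mp.
case Em: m => [//|k]; rewrite ltnS => pk.
have f0 : forall i, (f i)`_k = 0.
  apply: sum_sqr_eq0.
  transitivity ((\sum_i f i ^+ 2)`_(k + k)).
    by rewrite coef_sum; apply: eq_bigr => i _; rewrite coef_sqr_top // -Em.
  by rewrite e coef_sqr_top 1?nth_default ?expr0n // leqW.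
suff : (m <= k)%N by rewrite Em ltnn.
apply/bigmax_leqP => i _; have := fm i; rewrite Em leq_eqVlt => /orP[/eqP si|//].
have := f0 i; rewrite -[k]/(k.+1.-1) -si => /eqP.
by rewrite -lead_coefE lead_coef_eq0 -size_poly_eq0 si.
Qed.

(** A complex root z = a + b i of [q] gives M = (X - a)^2 + b^2. The remainder of [q] modulo M has
    degree at most 1 and vanishes at z; as b is nonzero, for want of real roots, its imaginary and
    then its real part force it to be 0. *)
Lemma rootfree_quadratic_factor q : (1 < size q)%N -> (forall t, ~~ root q t) ->
  exists2 M, M %| q & M \is monic /\ size M = 3%N.
Proof.
move=> sq nr; pose c : {rmorphism R -> R[i]} := real_complex R.
have /closed_rootP[z] : size (map_poly c q) != 1.
  by rewrite size_map_poly; case: ltngtP sq.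
case: z => a b qz.
pose r : {poly R} := - (2%:R * a) *: 'X + (a ^+ 2 + b ^+ 2)%:P.
have sr : (size r < size ('X^2 : {poly R}))%N.
  rewrite size_polyXn (leq_ltn_trans (size_polyD _ _)) // gtn_max.
  rewrite (leq_ltn_trans (size_scale_leq _ _)) ?size_polyX //.
  by rewrite (leq_ltn_trans (size_polyC_leq1 _)).
pose M := 'X^2 + r.
have Mm : M \is monic by rewrite monicE (lead_coefDl sr) lead_coefXn.
have sM : size M = 3%N by rewrite /M (size_polyDl sr) size_polyXn.
exists M => //.
have lin u v : (map_poly c (u *: 'X + v%:P)).[(a +i* b)%C] =
    ((u * a + v) +i* (u * b))%C.
  rewrite rmorphD /= map_polyZ map_polyX map_polyC /= !hornerE.
  by apply/eqP; rewrite eq_complex /= !(mul0r, subr0, addr0) !eqxx.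
have Mz : (map_poly c M).[(a +i* b)%C] = 0.
  rewrite /M /r rmorphD hornerD lin /= map_polyXn hornerXn.
  by apply/eqP; rewrite eq_complex /=; apply/andP; split; apply/eqP; ring.
have M0 : M != 0 by rewrite monic_neq0.
have := qz; rewrite /root {1}(divp_eq q M) rmorphD rmorphM /= hornerD hornerM.
rewrite Mz mulr0 add0r.
have : (size (q %% M)%R <= 2)%N by rewrite -ltnS -sM ltn_modp.
rewrite /dvdp; set s := (q %% M)%R => ss.
have -> : s = s`_1 *: 'X + (s`_0)%:P.
  apply/polyP => i; rewrite !coefE.
  case: i => [|[|i]] /=; rewrite ?mulr0 ?mulr1 ?addr0 ?add0r //.
  by rewrite nth_default ?(leq_trans ss).
rewrite lin eq_complex /= => /andP[/eqP e1 /eqP e2].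
have b0 : b != 0.
  apply/eqP => b0; have /negP[] := nr a.
  by rewrite -(fmorph_root c) /c /=; move: qz; rewrite b0.
have s1 : s`_1 = 0 by apply/eqP; move/eqP: e2; rewrite mulf_eq0 (negPf b0) orbF.
by move: e1; rewrite s1 mul0r add0r scale0r => ->; rewrite addr0.
Qed.

End Polynomials.

(** * Divisibility and primitivity of quaternion polynomials *)

Section QuaternionPolynomials.
Variable R : realType.
Implicit Types (p q f M : {poly R}) (a b h k : 'cV[{poly R}]_4).

Definition primitive a := forall p, (forall i, p %| a i 0) -> p %= 1.

(** The gcd of the [f * b j 0] is [f] times the gcd of the coordinates of [b], which is a unit. *)
Lemma primitive_dvdp b p f :
  primitive b -> (forall j, p %| f * b j 0) -> p %| f.
Proof.
move=> pb pfb.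
pose g := gcdp (gcdp (b o0 0) (b o1 0)) (gcdp (b o2 0) (b o3 0)).
have g1 : g %= 1.
  have : g %| g by []; rewrite {2}/g !dvdp_gcd => /andP[/andP[g0 g1] /andP[g2 g3]].
  by apply: pb; apply: ord4P.
have -> : (p %| f) = (p %| f * g).
  by rewrite (eqp_dvdr _ (eqp_mull f g1)) mulr1.
rewrite (eqp_dvdr _ (mulp_gcdr _ _ _)) dvdp_gcd.
by rewrite !(eqp_dvdr _ (mulp_gcdr _ _ _)) !dvdp_gcd !pfb.
Qed.

Lemma dvdp_sumr (I : finType) (F : I -> {poly R}) p :
  (forall i, p %| F i) -> p %| \sum_i F i.
Proof.
move=> pF; elim/big_ind: _ => [|x y|i _]; first exact: dvdp0.
  exact: dvdp_add.
exact: pF.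
Qed.

Lemma dvdp_biggcd (I : eqType) (s : seq I) (F : I -> {poly R}) p q :
  (p %| \big[@gcdp R/q]_(i <- s) F i) = (p %| q) && all (fun i => p %| F i) s.
Proof.
elim: s => [|i s IH]; first by rewrite big_nil andbT.
by rewrite big_cons dvdp_gcd IH /= andbCA.
Qed.

Lemma dvdp_assoc p (X : 'M[{poly R}]_4) :
  (forall i j, p %| X i j) -> forall i j, p %| assoc X i j.
Proof.
move=> pX i j; elim/ord4P: i; elim/ord4P: j; rewrite /assoc /tab4 /=;
  by rewrite !(dvdp_add, dvdp_sub, dvdpNr).
Qed.

Lemma dvdp_lmx p a : (forall i, p %| a i 0) -> forall i j, p %| lmx a i j.
Proof.
move=> pa i j; rewrite mxE.
by elim/ord4P: i; elim/ord4P: j; rewrite /tab4 /= ?dvdpNr pa.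
Qed.

Lemma dvdp_rmx p a : (forall i, p %| a i 0) -> forall i j, p %| rmx a i j.
Proof.
move=> pa i j; rewrite mxE.
by elim/ord4P: i; elim/ord4P: j; rewrite /tab4 /= ?dvdpNr pa.
Qed.

Lemma dvdp_mulmxl m n r p (A : 'M[{poly R}]_(m, n)) (B : 'M_(n, r)) :
  (forall i j, p %| A i j) -> forall i j, p %| (A *m B) i j.
Proof. by move=> pA i j; rewrite mxE; apply: dvdp_sumr => l; exact: dvdp_mulr. Qed.

Lemma dvdp_mulmxr m n r p (A : 'M[{poly R}]_(m, n)) (B : 'M_(n, r)) :
  (forall i j, p %| B i j) -> forall i j, p %| (A *m B) i j.
Proof. by move=> pB i j; rewrite mxE; apply: dvdp_sumr => l; exact: dvdp_mull. Qed.

Lemma primitive_mull a b : primitive (lmx a *m b) -> primitive a.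
Proof. by move=> pab p pa; apply: pab => i; apply: dvdp_mulmxl; apply: dvdp_lmx. Qed.

Lemma primitive_mulr a b : primitive (lmx a *m b) -> primitive b.
Proof.
move=> pab p pb; apply: pab => i.
by apply: dvdp_mulmxr => l j; rewrite (ord1 j).
Qed.

Lemma primitive_conj a : primitive a -> primitive (qconj a).
Proof.
move=> pa p pca; apply: pa => i; have := pca i.
by rewrite mxE; case: ifP => _; rewrite ?dvdpNr.
Qed.

(** * Norms of quaternion polynomials and their linear factors *)

Lemma qnorm_eq0 a : qnorm a = 0 -> a = 0.
Proof.
move=> a0; apply/matrixP => i j; rewrite (ord1 j) mxE.
apply: poly_fun_ext => t; rewrite horner0.
apply: (@sum_sqr_eq0 R (fun i => (a i 0).[t])).
transitivity (qnorm a).[t]; last by rewrite a0 horner0.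
by rewrite /qnorm horner_sum; apply: eq_bigr => l _; rewrite horner_exp.
Qed.

(** A real root of a sum of squares is a root of every summand, so X - t would divide all
    coordinates. *)
Lemma primitive_qnorm_root a t : primitive a -> ~~ root (qnorm a) t.
Proof.
move=> pa; apply/negP => /rootP; rewrite /qnorm horner_sum => a0.
have /pa/eqp_size : forall i, 'X - t%:P %| a i 0.
  move=> i; rewrite dvdp_XsubCl; apply/rootP; move: i.
  by apply: sum_sqr_eq0; rewrite -[RHS]a0; apply: eq_bigr => l _; rewrite horner_exp.
by rewrite size_XsubC size_poly1.
Qed.

(* Modulo [M], [a] is a linear quaternion polynomial [c] with leading coefficient [v],
   and [M] divides [qnorm c]; hence [h] is the monic associate [c v^-1]. *)
Lemma primitive_left_factor a M :
  primitive a -> M \is monic -> size M = 3%N -> M %| qnorm a ->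
  exists h a', a = lmx h *m a' /\ qnorm h = M.
Proof.
move=> pa Mm sM Ma; have M0 := monic_neq0 Mm.
pose c : 'cV[{poly R}]_4 := \col_i (a i 0 %% M).
pose e : 'cV[{poly R}]_4 := \col_i (a i 0 %/ M).
pose v : 'cV[{poly R}]_4 := \col_i ((a i 0 %% M)`_1)%:P.
pose n : R := \sum_i (a i 0 %% M)`_1 ^+ 2.
have nv : qnorm v = n%:P.
  by rewrite /n rmorph_sum /=; apply: eq_bigr => i _; rewrite mxE rmorphXn.
have aE i : a i 0 = c i 0 + M * e i 0 by rewrite !mxE mulrC addrC -divp_eq.
have ace : a = c + M *: e.
  by apply/matrixP => i j; rewrite (ord1 j) aE [RHS]mxE [(M *: e) i _]mxE.
have sc i : (size (c i 0)%R <= 2)%N.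
  by rewrite mxE -ltnS; have := ltn_modp (a i 0) M; rewrite sM M0.
have Mc : M %| qnorm c.
  have -> : qnorm c = qnorm a - \sum_i M * (e i 0 * (c i 0 *+ 2 + M * e i 0)).
    rewrite /qnorm -sumrB; apply: eq_bigr => i _.
    by rewrite aE; ring.
  by rewrite dvdp_sub // dvdp_sumr // => i; rewrite dvdp_mulIl.
(* Both sides have degree at most 2 and [M] is monic, so the constant quotient is the coefficient of
   X^2 in [qnorm c]. *)
have cM : qnorm c = n *: M.
  have snc : (size (qnorm c) <= 3)%N.
    apply: (leq_trans (size_sum _ _ _)); apply/bigmax_leqP => i _.
    rewrite expr2 (leq_trans (size_polyMleq _ _)) //.
    by move: (sc i); case: (size _) => [|[|[|]]].
  have /size1_polyC dE : (size (qnorm c %/ M)%R <= 1)%N.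
    by rewrite size_divp // sM leq_subLR.
  have := divpK Mc; rewrite dE; set k := _`_0 => <-; rewrite mul_polyC.
  congr (_ *: _).
  have : (qnorm c)`_2 = n.
    rewrite coef_sum; apply: eq_bigr => i _.
    by rewrite (@coef_sqr_top _ _ 1) // mxE.
  rewrite -(divpK Mc) dE -/k mul_polyC coefZ => <-.
  by move: Mm; rewrite monicE lead_coefE sM => /eqP ->; rewrite mulr1.
(* Primitivity enters here: [n = 0] would force [c = 0], and [M] would divide [a]. *)
have n0 : n != 0.
  apply/eqP => n0; have c0 : c = 0 by apply: qnorm_eq0; rewrite cM n0 scale0r.
  suff /eqp_size : M %= 1 by rewrite sM size_poly1.
  by apply: pa => i; rewrite aE c0 mxE add0r dvdp_mulIl.
pose h := (n^-1)%:P *: (lmx c *m qconj v).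
have nh : qnorm h = M.
  rewrite /h qnormZ qnormM qnorm_conj nv cM -rmorphXn /=.
  rewrite mulrC -mulrA -rmorphM /= mulrC mul_polyC scalerA.
  by rewrite expr2 mulrA divff // mul1r mulVf // scale1r.
(* The transpose of [lmx h] is left multiplication by the conjugate of h. Since h v = c and h times
   its conjugate is M, the product of h with this witness is c + M e = a. *)
exists h, (v + (lmx h)^T *m e); split => //.
rewrite mulmxDr mulmxA lmxV nh mul_scalar_mx {1}/h lmxZ -scalemxAl lmx_conj_mul nv.
by rewrite scalerA -rmorphM /= mulVf // scale1r.
Qed.

(** Conjugation reverses products, so this is the left factorization of [qconj b]. *)
Lemma primitive_right_factor b M :
  primitive b -> M \is monic -> size M = 3%N -> M %| qnorm b ->
  exists k b', b = lmx b' *m k /\ qnorm k = M.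
Proof.
move=> pb Mm sM Mb.
have [|h [a' [e nh]]] := primitive_left_factor (primitive_conj pb) Mm sM.
  by rewrite qnorm_conj.
exists (qconj h), (qconj a'); split; last by rewrite qnorm_conj.
by rewrite -qconjM -e qconjK.
Qed.

(** * Curves given by pairs of quaternion polynomials *)

Definition qcurve a b q (t : R) : 'M[R]_4 :=
  (q.[t])^-1 *: map_mx (horner_eval t) (lmx a *m rmx b).

Lemma norm_root a b q t :
  primitive a -> primitive b -> qnorm a * qnorm b = q ^+ 2 -> ~~ root q t.
Proof.
move=> pa pb e; apply/negP => /rootP qt.
have : root (qnorm a * qnorm b) t by rewrite e /root horner_exp qt expr0n.
by rewrite rootM !(negPf (primitive_qnorm_root _ _)).
Qed.

Lemma qcurve_SO4 a b q t : primitive a -> primitive b ->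
  qnorm a * qnorm b = q ^+ 2 -> qcurve a b q t \in SO4.
Proof.
move=> pa pb e; have q0 : q.[t] != 0 by exact: norm_root e.
rewrite inE; apply/andP; split; apply/eqP.
  rewrite /qcurve linearZ /= -scalemxAl -scalemxAr scalerA map_trmx -map_mxM lrmxV e.
  rewrite map_scalar_mx /= horner_evalE horner_exp scale_scalar_mx.
  by congr (_%:M); field.
rewrite /qcurve detZ det_map_mx det_mulmx det_lmx det_rmx -exprMn e.
by rewrite /= horner_evalE !horner_exp; field.
Qed.

Lemma quadratic_qcurve h k M : primitive h -> primitive k ->
  qnorm h * qnorm k = M ^+ 2 -> size M = 3%N ->
  rational_curve_of_degree (qcurve h k M) 2.
Proof.
move=> ph pk e sM; split; first by move=> t; exact: qcurve_SO4.
exists (lmx h *m rmx k), M; split => //; split.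
- by move=> t; exact: norm_root e.
(* A common divisor of the entries divides every 4 h_i k_j, since these are the entries of the
   associate matrix; primitivity of [k] and then of [h] makes it a unit. *)
- set g := \big[_/_]_i _.
  have : g %| g by [].
  rewrite {2}/g dvdp_biggcd => /andP[_ /allP gP].
  apply: ph => i; apply: (primitive_dvdp pk) => j.
  have : g %| assoc (lmx h *m rmx k) i j.
    by apply: dvdp_assoc => l m; exact: (gP (l, m) (mem_index_enum _)).
  by rewrite assoc_lrmx -polyC_natr mul_polyC dvdpZr ?pnatr_eq0.
(* The squares of the entries in each row sum to [M ^+ 2], which bounds the degrees. *)
- move=> i; apply: (@size_sum_sqr R (fun j => (lmx h *m rmx k) i j)).
  have := congr1 (fun A : 'M_4 => A i i) (lrmxV h k).
  rewrite e mxE [RHS]mxE eqxx mulr1n => <-.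
  by apply: eq_bigr => j _; rewrite expr2; congr (_ * _); rewrite [RHS]mxE.
- move=> t; rewrite /qcurve; move: (lmx h *m rmx k) => P.
  by apply/matrixP => i j; rewrite !mxE mulrC.
Qed.

(** * Splitting off quadratic curves *)

Lemma irreducible_sqr_dvdp M p q : irreducible_poly M -> M ^+ 2 %| p * q ->
  [\/ M %| p /\ M %| q, M ^+ 2 %| p | M ^+ 2 %| q].
Proof.
move=> irrM Mpq.
have [Mp|Mp] := boolP (M %| p); last first.
  constructor 3; rewrite -(Gauss_dvdpr _ (_ : coprimep _ p)) //.
  by rewrite coprimep_expl // irreducible_poly_coprime.
have [Mq|Mq] := boolP (M %| q); first by constructor 1.
constructor 2; rewrite -(Gauss_dvdpl _ (_ : coprimep _ q)) //.
by rewrite coprimep_expl // irreducible_poly_coprime.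
Qed.

(** The left side is x |-> h (a x b) k up to the denominator. As [rmx] reverses products, it
    suffices to move [lmx a] past [rmx k], and these commute. *)
Lemma qcurve_mul h k M a b q t :
  qcurve (lmx h *m a) (lmx b *m k) (M * q) t = qcurve h k M t *m qcurve a b q t.
Proof.
rewrite /qcurve -scalemxAl -scalemxAr scalerA -map_mxM hornerM invfM.
congr (_ *: map_mx _ _); rewrite lmxM rmxM.
by rewrite -!mulmxA; congr (_ *m _); rewrite !mulmxA lrmxC.
Qed.

(** [delta_mx 0 0] is the quaternion 1. It serves as the trivial factor on one side when both linear
    factors come from the other. *)
Lemma qnorm_one : qnorm (delta_mx 0 0) = 1 :> {poly R}.
Proof. by rewrite /qnorm sum4 !mxE /= expr1n !expr0n !addr0. Qed.

Lemma lmx_one_mul a : lmx (delta_mx 0 0) *m a = a.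
Proof.
have -> : lmx (delta_mx 0 0) = 1%:M :> 'M[{poly R}]_4; last by rewrite mul1mx.
apply/matrixP => i j; rewrite !mxE /=.
by elim/ord4P: i; elim/ord4P: j; rewrite /tab4 /= ?oppr0.
Qed.

Lemma lmx_mul_one a : lmx a *m delta_mx 0 0 = a.
Proof.
apply/matrixP => i j; rewrite (ord1 j) !mxE sum4 !mxE.
by elim/ord4P: i; rewrite /tab4 /= ?mulr1 ?mulr0 ?addr0 ?add0r.
Qed.

Lemma peel_quadratic a b q :
  primitive a -> primitive b -> qnorm a * qnorm b = q ^+ 2 -> (1 < size q)%N ->
  exists h a' b' k M q', [/\ a = lmx h *m a', b = lmx b' *m k & q = M * q'] /\
    [/\ qnorm h * qnorm k = M ^+ 2, qnorm a' * qnorm b' = q' ^+ 2 & size M = 3%N].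
Proof.
move=> pa pb e sq; have nr t := norm_root t pa pb e.
have [M Mq [Mm sM]] := rootfree_quadratic_factor sq nr.
have M0 := monic_neq0 Mm.
have irrM : irreducible_poly M.
  apply: cubic_irreducible => [|t]; first by rewrite sM.
  by apply: contra (nr t) => /rootP Mt; rewrite /root -(divpK Mq) hornerM Mt mulr0.
have qE : q = M * (q %/ M) by rewrite mulrC divpK.
(* The norm identity for the remaining pair follows by cancelling [M ^+ 2]. *)
suff [h [a' [b' [k [ea eb nhk]]]]] : exists h a' b' k,
    [/\ a = lmx h *m a', b = lmx b' *m k & qnorm h * qnorm k = M ^+ 2].
  exists h, a', b', k, M, (q %/ M); do 2!split => //.
  apply: (mulfI (expf_neq0 2 M0)); rewrite -exprMn -qE -e ea eb !qnormM -nhk.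
  by rewrite -!mulrA; congr (_ * _); rewrite mulrCA; congr (_ * _); rewrite mulrC.
have : M ^+ 2 %| qnorm a * qnorm b by rewrite e dvdp_pexp2r.
case/(irreducible_sqr_dvdp irrM) => [[Ma Mb]|M2|M2].
- have [h [a' [ea nh]]] := primitive_left_factor pa Mm sM Ma.
  have [k [b' [eb nk]]] := primitive_right_factor pb Mm sM Mb.
  by exists h, a', b', k; split; rewrite // nh nk.
- have [|h [a1 [ea nh]]] := primitive_left_factor pa Mm sM.
    exact: dvdp_trans (dvdp_exp _ _) M2.
  have pa1 : primitive a1 by move: pa; rewrite ea; exact: primitive_mulr.
  have [|h' [a' [ea1 nh']]] := primitive_left_factor pa1 Mm sM.
    by move: M2; rewrite ea qnormM nh expr2 dvdp_mul2l.
  exists (lmx h *m h'), a', b, (delta_mx 0 0).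
  rewrite lmx_mul_one lmxM -mulmxA -ea1 -ea qnorm_one mulr1 qnormM nh nh'.
  by [].
- have [|k [b1 [eb nk]]] := primitive_right_factor pb Mm sM.
    exact: dvdp_trans (dvdp_exp _ _) M2.
  have pb1 : primitive b1 by move: pb; rewrite eb; exact: primitive_mull.
  have [|k' [b' [eb1 nk']]] := primitive_right_factor pb1 Mm sM.
    by move: M2; rewrite eb qnormM nk expr2 dvdp_mul2r.
  exists (delta_mx 0 0), a, b', (lmx k' *m k).
  rewrite lmx_one_mul mulmxA -lmxM -eb1 -eb qnorm_one mul1r qnormM nk nk'.
  by [].
Qed.

Lemma qcurve_factorization d a b q : primitive a -> primitive b ->
  qnorm a * qnorm b = q ^+ 2 -> size q = (2 * d.+1).+1%N ->
  exists gs : 'I_d.+1 -> R -> 'M[R]_4,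
    (forall i, rational_curve_of_degree (gs i) 2) /\
    (forall t, qcurve a b q t = \prod_i gs i t).
Proof.
elim: d a b q => [|d IH] a b q pa pb e sq.
  exists (fun=> qcurve a b q); split => [_|t]; first exact: quadratic_qcurve.
  by rewrite big_ord1.
have [|h [a' [b' [k [M [q' [[ea eb eq] [nhk nab sM]]]]]]]] := peel_quadratic pa pb e.
  by rewrite sq.
(* Factors of primitive products are primitive: this gives the induction hypothesis for a', b' and
   the quadratic curve of h, k. *)
rewrite ea in pa; rewrite eb in pb.
have M0 : M != 0 by rewrite -size_poly_eq0 sM.
have q0 : q' != 0 by apply: contra_eq_neq sq => q'0; rewrite eq q'0 mulr0 size_poly0.
have sq' : size q' = (2 * d.+1).+1%N.
  by move: sq; rewrite eq size_mul // sM mulnS => -[].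
have [gs [gsP gsE]] := IH _ _ _ (primitive_mulr pa) (primitive_mull pb) nab sq'.
exists (fun i => if unlift ord0 i is Some j then gs j else qcurve h k M); split.
  move=> i; case: unliftP => [j _|_]; first exact: gsP.
  exact: quadratic_qcurve (primitive_mull pa) (primitive_mulr pb) nhk sM.
move=> t; rewrite big_ord_recl unlift_none ea eb eq qcurve_mul gsE.
by congr (_ * _); apply: eq_bigr => i _; rewrite liftK.
Qed.

(** * From a rational curve on SO_4 to a pair of quaternion polynomials *)

(** On SO_4 the right side of [assoc_gram] is 4 * 4^2 + 8 * 4 - 96 = 0, so a sum of squares of all
    real minors vanishes, and so does each minor. The sign of the determinant is decisive here. *)
Lemma SO4_assoc_minor (X : 'M[R]_4) : X \in SO4 ->
  forall i j m l, assoc X i j * assoc X m l = assoc X i l * assoc X m j.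
Proof.
rewrite inE => /andP[/eqP XX /eqP dX].
have H i m : \sum_j X i j * X m j = (i == m)%:R.
  have := congr1 (fun A : 'M_4 => A i m) XX; rewrite !mxE => <-.
  by apply: eq_bigr => j _; rewrite mxE.
have E : \sum_i \sum_m \sum_j \sum_l
    (assoc X i j * assoc X m l - assoc X i l * assoc X m j) ^+ 2 = 0.
  transitivity (2%:R * \sum_i \sum_m ((\sum_j assoc X i j * assoc X i j)
     * (\sum_j assoc X m j * assoc X m j) - (\sum_j assoc X i j * assoc X m j) ^+ 2)).
    rewrite mulr_sumr; apply: eq_bigr => i _; rewrite mulr_sumr; apply: eq_bigr => m _.
    exact: lagrange4.
  rewrite assoc_gram -det4E dX (eq_bigr _ (fun i _ => H i i)).
  under [X in _ + _ * X]eq_bigr => i _ do under eq_bigr => m _ do rewrite H.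
  by rewrite !sum4 /=; ring.
move=> i j m l; apply/eqP; rewrite -subr_eq0 -sqrf_eq0; apply/eqP.
have z (F : 'I_4 -> R) : (forall c, 0 <= F c) -> \sum_c F c = 0 -> forall c, F c = 0.
  by move=> F0 F00 c; apply: (psumr_eq0P _ F00).
pose D i m j l := (assoc X i j * assoc X m l - assoc X i l * assoc X m j) ^+ 2.
have D0 i' m' j' l' : 0 <= D i' m' j' l' by exact: sqr_ge0.
have D1 i' m' j' : 0 <= \sum_l D i' m' j' l by exact: sumr_ge0.
have D2 i' m' : 0 <= \sum_j \sum_l D i' m' j l by exact: sumr_ge0.
have D3 i' : 0 <= \sum_m \sum_j \sum_l D i' m j l by exact: sumr_ge0.
exact: z _ (D0 _ _ _) (z _ (D1 _ _) (z _ (D2 _) (z _ D3 E i) m) j) l.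
Qed.

(** No denominators arise: [a] is column [j0] divided by its gcd, hence primitive, and therefore
    [a i0 0] divides the whole row [i0]; the quotient is [b]. *)
Lemma rank_one_factor (C : 'I_4 -> 'I_4 -> {poly R}) i0 j0 : C i0 j0 != 0 ->
  (forall i j m l, C i j * C m l = C i l * C m j) ->
  exists a b, forall i j, C i j = a i 0 * b j 0.
Proof.
move=> C0 CC.
(* The starting value is itself an entry of column [j0], so [g] is the gcd of exactly that
   column. *)
pose g := \big[@gcdp R/C i0 j0]_(i : 'I_4) C i j0.
have gP p : (p %| g) = (p %| C i0 j0) && all (fun i => p %| C i j0) (index_enum _).
  exact: dvdp_biggcd.
have gC i : g %| C i j0.
  have := dvdpp g; rewrite gP => /andP[_ /allP]; apply; exact: mem_index_enum.
have g0 : g != 0 by apply: contra_neq C0 => g0; apply/eqP; rewrite -dvd0p -g0 gC.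
pose a : 'cV[{poly R}]_4 := \col_i (C i j0 %/ g).
have aE i : C i j0 = a i 0 * g by rewrite mxE divpK.
have pa : primitive a.
  move=> p pa; rewrite -size_poly_eq1 -dvdp1 -(dvdp_mul2r _ _ g0) mul1r gP.
  rewrite aE dvdp_mul2r // pa.
  by apply/allP => i _; rewrite aE dvdp_mul2r.
have a0 : a i0 0 != 0 by apply: contra_neq C0; rewrite aE => ->; rewrite mul0r.
have aC i j : a i 0 * C i0 j = C i j * a i0 0.
  apply: (mulIf g0); rewrite mulrAC -aE -[RHS]mulrA -aE mulrC [RHS]mulrC.
  by rewrite mulrC CC mulrC.
have aCj j : a i0 0 %| C i0 j.
  by apply: (primitive_dvdp pa) => i; rewrite mulrC aC dvdp_mull.
clearbody a; exists a, (\col_j (C i0 j %/ a i0 0)) => i j.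
by apply: (mulIf a0); rewrite [in RHS]mxE -mulrA divpK // aC.
Qed.

Lemma horner_assoc (P : 'M[{poly R}]_4) t i j :
  (assoc P i j).[t] = assoc (map_mx (horner_eval t) P) i j.
Proof.
elim/ord4P: i; elim/ord4P: j; rewrite /assoc /tab4 /= !mxE; rewrite !horner_evalE.
all: by rewrite !hornerE.
Qed.

Lemma presentation_qcurve gamma P q : curve_presentation gamma P q ->
  (forall t, gamma t \in SO4) ->
  exists a b, [/\ primitive a, primitive b, qnorm a * qnorm b = q ^+ 2 &
    forall t, gamma t = qcurve a b q t].
Proof.
move=> [nr cop _ ev] so; pose ht t := @horner_eval R t.
have q0 t : q.[t] != 0 by exact: nr.
have gE t : gamma t = (q.[t])^-1 *: map_mx (ht t) P.
  by rewrite ev; apply/matrixP => i j; rewrite !mxE mulrC.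
have PE t : map_mx (ht t) P = q.[t] *: gamma t by rewrite gE scalerA divff ?scale1r.
(* At each t, [assoc P] is q(t) times the associate matrix of a point of SO_4, whose minors
   vanish. *)
have CC i j m l : assoc P i j * assoc P m l = assoc P i l * assoc P m j.
  apply: poly_fun_ext => t; rewrite !hornerM !horner_assoc PE !assocZ.
  by rewrite mulrACA SO4_assoc_minor // mulrACA.
have P0 : P != 0.
  apply/eqP => P0; have := so 0; rewrite gE P0 map_mx0 scaler0 inE mul0mx => /andP[/eqP].
  by move/matrixP/(_ 0 0)/eqP; rewrite !mxE eq_sym oner_eq0.
have [/existsP[i0 /existsP[j0 C0]]|C0] :=
  boolP [exists i, exists j, assoc P i j != 0]; last first.
  case/eqP: P0; suff : 4%:R *: P = 0.
    by move/eqP; rewrite scalemx_eq0 -polyC_natr polyC_eq0 pnatr_eq0 => /eqP.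
  rewrite -assocK (@eq_unassoc _ _ (fun i j => (0 : 'cV_4) i 0 * (0 : 'cV_4) j 0)).
    by rewrite -lrmx_unassoc -(scale0r 0) lmxZ scale0r mul0mx.
  move=> i j; rewrite !mxE mulr0; apply/eqP; move: C0; rewrite negb_exists.
  by move=> /forallP/(_ i); rewrite negb_exists => /forallP/(_ j); rewrite negbK.
have [a [b ab]] := rank_one_factor C0 CC.
(* The scalar absorbs the factor 4 of [assocK]. *)
pose a' := (4^-1)%:P *: a.
have PL : P = lmx a' *m rmx b.
  rewrite lmxZ -scalemxAl lrmx_unassoc -(eq_unassoc ab) assocK scalerA.
  by rewrite -polyC_natr -rmorphM /= mulVf ?pnatr_eq0 // scale1r.
have nab : qnorm a' * qnorm b = q ^+ 2.
  apply: poly_fun_ext => t; have := so t; rewrite inE => /andP[/eqP XX _].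
  have := lrmxV a' b; rewrite -PL => /(congr1 (map_mx (ht t))).
  rewrite map_mxM -map_trmx PE linearZ /= -scalemxAl -scalemxAr XX.
  move/matrixP/(_ 0 0); rewrite !mxE /= !mulr1n mulr1 => /esym nab.
  by rewrite [LHS]nab horner_exp expr2.
have copP p : p %| q -> (forall i j, p %| P i j) -> p %= 1.
  move=> pq pP; rewrite -size_poly_eq1 -dvdp1 -(eqp_dvdr _ cop) dvdp_biggcd pq.
  by apply/allP => ij _; exact: pP.
(* If p divides [a'] or [b], then p^2 divides the product of the norms, which is q^2. So p divides
   [q] as well as all entries of [P], and the gcd condition of the presentation makes it a unit. *)
have sqr_dvd p (c : 'cV_4) : (forall i, p %| c i 0) -> p ^+ 2 %| qnorm c.
  by move=> pc; apply: dvdp_sumr => i; rewrite dvdp_pexp2r.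
exists a', b; split => // [p pa|p pb|t]; last by rewrite /qcurve -PL gE.
  apply: copP => [|i j]; last by rewrite PL; apply: dvdp_mulmxl; exact: dvdp_lmx.
  by rewrite -(@dvdp_pexp2r _ _ _ 2) // -nab dvdp_mulr // sqr_dvd.
apply: copP => [|i j]; last by rewrite PL; apply: dvdp_mulmxr; exact: dvdp_rmx.
by rewrite -(@dvdp_pexp2r _ _ _ 2) // -nab dvdp_mull // sqr_dvd.
Qed.

End QuaternionPolynomials.

Theorem theoremB (R : realType) (d : nat) (hd : (1 <= d)%N)
    (gamma : R -> 'M[R]_4)
    (hgamma : rational_curve_of_degree gamma (2 * d)%N) :
  exists gammas : 'I_d -> R -> 'M[R]_4,
    (forall k : 'I_d, rational_curve_of_degree (gammas k) 2%N) /\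
    (forall t : R, gamma t = \prod_(k < d) gammas k t).
Proof.
case: d hd hgamma => [//|d] _ [so [P [q [pres sq]]]].
have [a [b [pa pb e gE]]] := presentation_qcurve pres so.
have [gs [gsP gsE]] := qcurve_factorization pa pb e sq.
by exists gs; split => // t; rewrite gE gsE.
Qed.
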